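(* Let $\mathcal{S}_{n,L,\lambda,\sigma,\tau,z}$ be the colored stochastic symplectic ice with $\sigma,\tau\in B_n$, $\lambda=(\lambda_1\ge\dots\ge\lambda_n\ge0)$ a partition and $L\ge\lambda_1+n$. Assume that $\sigma(n)>0$. Let $s_n\in B_n$ be the element with $s_n(k)=k$ for $1\le k\le n-1$ and $s_n(n)=\bar n$, and let $s_nz=(z_1,\dots,z_{n-1},\frac1{z_n'})$. Then $$\Bigl(\frac{q}{z_n}\Bigr)^{L}Z(\mathcal{S}_{n,L,\lambda,\sigma s_n,\tau,z})=C(q,z)\,z_n^{-L}\,Z(\mathcal{S}_{n,L,\lambda,\sigma,\tau,z})-D(q,z)\,z_n'^{L}\,Z(\mathcal{S}_{n,L,\lambda,\sigma,\tau,s_nz}),$$ where $$C(q,z)=\frac{(q-z_n')(z_n-1)}{q(1-z_nz_n')},\qquad D(q,z)=\frac{qz_n+z_n'-(q+1)z_nz_n'}{q(1-z_nz_n')}.$$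
   Context: Parameters: $q,z_1,\dots,z_n$ are indeterminates (equivalently, generic complex numbers for which every denominator is nonzero); $z_i'=q+1-\frac1{z_i}$. (For the parameter vector $s_nz$, the last spectral parameter is $1/z_n'$, whose associated primed quantity is $q+1-z_n'=1/z_n$.) Colors and group. Labels are $[\pm n]\cup\{0\}$, with $[\pm n]=\{\bar n,\dots,\bar1,1,\dots,n\}$, $\overline{\bar k}=k$ ($\bar k$ is also thought of as $-k$), ordered by $\bar n<\dots<\bar1<0<1<\dots<n$. The colors are $c_\alpha$, $\alpha\in[\pm n]$, and $c_0:=+$. $B_n$ is the hyperoctahedral group of permutations $\sigma$ of $[\pm n]$ with $\sigma(\bar k)=\overline{\sigma(k)}$; products are composed right to left, $(\sigma\tau)(k)=\sigma(\tau(k))$. Vertex weights, as functions of the colors (left, top, right, bottom); unlisted configurations have weight $0$. For every color $x$, $(x,x,x,x)\mapsto1$, and for all labels $\alpha<\beta$: - colored stochastic $\Gamma$ vertex with spectral parameter $z_i$: $(c_\alpha,c_\beta,c_\alpha,c_\beta)\mapsto z_i$, $(c_\beta,c_\alpha,c_\beta,c_\alpha)\mapsto qz_i$, $(c_\beta,c_\alpha,c_\alpha,c_\beta)\mapsto1-qz_i$, $(c_\alpha,c_\beta,c_\beta,c_\alpha)\mapsto1-z_i$. - colored stochastic $\Delta$ vertex with spectral parameter $z_i$: $(c_\alpha,c_\beta,c_\alpha,c_\beta)\mapsto z_i'$, $(c_\beta,c_\alpha,c_\beta,c_\alpha)\mapsto\frac1qz_i'$, $(c_\beta,c_\beta,c_\alpha,c_\alpha)\mapsto1-z_i'$,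 $(c_\alpha,c_\alpha,c_\beta,c_\beta)\mapsto1-\frac1qz_i'$. Model $\mathcal{S}_{n,L,\lambda,\sigma,\tau,z}$. A rectangular lattice with $2n$ rows numbered $1,\dots,2n$ from bottom to top and $L$ columns numbered $1,\dots,L$ from right to left; for $1\le i\le n$ row $2i-1$ consists of colored stochastic $\Delta$ vertices and row $2i$ of colored stochastic $\Gamma$ vertices, all with spectral parameter $z_i$. Boundary conditions: the left edge of row $2i$ carries $c_{\sigma(i)}$ and the left edge of row $2i-1$ carries $+$; all top edges carry $+$; the bottom edge in column $\lambda_i+n+1-i$ carries $c_{\tau(i)}$ for $1\le i\le n$, and other bottom edges carry $+$. On the right, rows $2i$ and $2i-1$ are joined by a cap with weight $K(x,y)$, $x$ and $y$ being the right-most colors of rows $2i$ and $2i-1$: $K(+,+)=1$, $K(c_\alpha,c_{\bar\alpha})=1$ for all $\alpha\in[\pm n]$, and $K=0$ otherwise. The partition function $Z$ is the sum, over all assignments of colors to the edges compatible with the boundary conditions, of the product of all vertex and cap weights. *)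

(* Defs.v *)
From HB Require Import structures.
From mathcomp Require Import all_boot all_order all_fingroup all_algebra.

Set Implicit Arguments.
Unset Strict Implicit.
Unset Printing Implicit Defensive.

Import Order.TTheory GRing.Theory Num.Theory.
Local Open Scope ring_scope.

(* The set [+-n]: (false, i) is the label i + 1 and (true, i) is its bar,
   i.e. the label -(i + 1). *)
Definition signed (n : nat) : finType := (bool * 'I_n)%type.

Definition pos (n : nat) (i : 'I_n) : signed n := (false, i).

Definition bar (n : nat) (k : signed n) : signed n := (~~ k.1, k.2).

(* [Some a] is c_a; [None] is c_0 = "+". *)
Definition color (n : nat) : finType := option (signed n).

Definition cbar (n : nat) (c : color n) : color n := omap (@bar n) c.

(* The order on the labels is that of their integer values. *)
Definition label (n : nat) (c : color n) : int :=
  match c with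
  | None => 0
  | Some (false, i) => (nat_of_ord i).+1%:Z
  | Some (true, i) => - (nat_of_ord i).+1%:Z
  end.

Definition clt (n : nat) (a b : color n) : bool := label a < label b.

(* Permutations multiply left to right here, (s * t) k = t (s k), so the product
   written sigma tau with right-to-left composition is (tau * sigma)%g. *)
Definition hyperoct (n : nat) : {set {perm signed n}} :=
  [set s : {perm signed n} | [forall k, s (bar k) == bar (s k)]].

Lemma hyperoct_group_set (n : nat) : group_set (hyperoct n).
Proof.
apply/group_setP; split=> [|s t].
  by rewrite inE; apply/forallP=> k; rewrite !perm1.
rewrite !inE => /forallP Hs /forallP Ht; apply/forallP=> k.
by rewrite !permM (eqP (Hs k)) (eqP (Ht _)).
Qed.

Canonical hyperoct_group (n : nat) : {group {perm signed n}} :=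
  Group (hyperoct_group_set n).

Definition s_last (n : nat) : {perm signed n.+1} :=
  tperm (pos ord_max) (bar (pos ord_max)).

Section Weights.
Variables (F : fieldType) (n : nat).
Implicit Types (q x : F) (l t r b : color n).

Definition zprime q x : F := q + 1 - x^-1.

(* Arguments: left, top, right, bottom. *)
Definition gamma_wt q x l t r b : F :=
  if [&& l == t, t == r & r == b] then 1
  else if (l == r) && (t == b) then if clt l t then x else q * x
  else if (l == b) && (t == r) then if clt l t then 1 - x else 1 - q * x
  else 0.

Definition delta_wt q x l t r b : F :=
  if [&& l == t, t == r & r == b] then 1
  else if (l == r) && (t == b) then
    if clt l t then zprime q x else q^-1 * zprime q x
  else if (l == t) && (r == b) then
    if clt r l then 1 - zprime q x else 1 - q^-1 * zprime q x
  else 0.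

Definition cap_wt (c d : color n) : F := (d == cbar c)%:R.

End Weights.

(* Rows, columns and i are all counted from 0, so each label is one less than in
   the 1-based numbering: the pair of rows with parameter z i consists of the
   Delta row i.*2 and the Gamma row i.*2.+1 just above it. *)
Lemma delta_row_subproof (n : nat) (i : 'I_n) : (i.*2 < n.*2)%N.
Proof. by rewrite ltn_double. Qed.

Lemma gamma_row_subproof (n : nat) (i : 'I_n) : (i.*2.+1 < n.*2)%N.
Proof. by rewrite ltn_Sdouble. Qed.

Definition delta_row (n : nat) (i : 'I_n) : 'I_n.*2 :=
  Ordinal (delta_row_subproof i).
Definition gamma_row (n : nat) (i : 'I_n) : 'I_n.*2 :=
  Ordinal (gamma_row_subproof i).

Section Model.
Variables (F : fieldType) (n L : nat).
Variables (lam : 'I_n -> nat) (sigma tau : {perm signed n}).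
Variables (q : F) (z : 'I_n -> F).

(* Columns are numbered from right to left, rows from bottom to top.  The vertex
   in row r and column j has right and left edges [hedge s r j], [hedge s r (j+1)]
   and bottom and top edges [vedge s r j], [vedge s (r+1) j].  So j = 0 and j = L
   give the right-most and left-most edges of a row, and r = 0 and r = 2n the
   bottom and top edges of a column. *)
Definition state : finType :=
  ({ffun 'I_n.*2 * 'I_L.+1 -> color n} *
   {ffun 'I_n.*2.+1 * 'I_L -> color n})%type.

Definition hedge (s : state) (r : 'I_n.*2) (j : 'I_L.+1) : color n := s.1 (r, j).
Definition vedge (s : state) (r : 'I_n.*2.+1) (j : 'I_L) : color n := s.2 (r, j).

Definition left_edge (s : state) (r : 'I_n.*2) (j : 'I_L) : color n :=
  hedge s r (lift ord0 j).
Definition right_edge (s : state) (r : 'I_n.*2) (j : 'I_L) : color n :=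
  hedge s r (widen_ord (leqnSn L) j).
Definition top_edge (s : state) (r : 'I_n.*2) (j : 'I_L) : color n :=
  vedge s (lift ord0 r) j.
Definition bottom_edge (s : state) (r : 'I_n.*2) (j : 'I_L) : color n :=
  vedge s (widen_ord (leqnSn n.*2) r) j.

(* For i counted from 0, the column lambda_i + n + 1 - i reads lam i + (n - i);
   these columns are pairwise distinct when lam is a partition. *)
Definition bottom_bc (j : 'I_L) : color n :=
  if [pick i : 'I_n | j.+1 == (lam i + (n - i))%N] is Some i
  then Some (tau (pos i)) else None.

Definition compatible (s : state) : bool :=
  [&& [forall i : 'I_n, hedge s (gamma_row i) ord_max == Some (sigma (pos i))],
      [forall i : 'I_n, hedge s (delta_row i) ord_max == None],
      [forall j : 'I_L, vedge s ord_max j == None]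
    & [forall j : 'I_L, vedge s ord0 j == bottom_bc j]].

Definition state_wt (s : state) : F :=
  \prod_(i < n)
    ((\prod_(j < L)
        (gamma_wt q (z i)
           (left_edge s (gamma_row i) j) (top_edge s (gamma_row i) j)
           (right_edge s (gamma_row i) j) (bottom_edge s (gamma_row i) j) *
         delta_wt q (z i)
           (left_edge s (delta_row i) j) (top_edge s (delta_row i) j)
           (right_edge s (delta_row i) j) (bottom_edge s (delta_row i) j))) *
     cap_wt F (hedge s (gamma_row i) ord0) (hedge s (delta_row i) ord0)).

Definition partition_function : F := \sum_(s | compatible s) state_wt s.

End Model.

Definition s_last_params (F : fieldType) (n : nat) (q : F) (z : 'I_n.+1 -> F) :
    'I_n.+1 -> F :=
  fun i => if i == ord_max then (zprime q (z ord_max))^-1 else z i.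

(* Main.v *)
(* Only the top Delta-Gamma pair of rows involves z_n and sigma(n), so, cutting
   the lattice below that pair, it suffices to prove the identity for the
   two-row partition functions with an arbitrary string of colors b on the
   bottom edges.  Since the top edges are +, a Gamma row with left color k either
   carries k to the cap, which returns it to the Delta row as its bar, or
   drops k once into the Delta row, which moves it weakly to the left.  Hence b
   must consist of a single color, k or its bar, in some column.  Columns to the
   left of that column scale all three terms by the same factor q, and what is
   left is an identity between geometric sums in z_n z_n'. *)
Require Import Defs.
From HB Require Import structures.
From mathcomp Require Import all_boot all_order all_fingroup all_algebra.
From mathcomp Require Import ring.

Set Implicit Arguments.
Unset Strict Implicit.
Unset Printing Implicit Defensive.

Import Order.TTheory GRing.Theory Num.Theory.
Local Open Scope ring_scope.

(** * Sums over the edges of a row as iterated sums *)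

Lemma sum_indicator (R : pzSemiRingType) (I : finType) (a : I) (f : I -> R) :
  \sum_i (i == a)%:R * f i = f a.
Proof.
rewrite (bigD1 a) //= eqxx mul1r big1 ?addr0 // => i /negPf->.
by rewrite mul0r.
Qed.

Section PathSum.
Variables (F : comPzSemiRingType) (T : finType).
Variables (w : nat -> T -> T -> F) (e : T -> F).

(** Transfer-matrix sum read from the left: index L is the leftmost edge, [w j] joins the left and
    right edges of column j, and [e] is the weight at the right end. *)
Fixpoint path_sum (L : nat) (x : T) : F :=
  if L is L'.+1 then \sum_y w L' x y * path_sum L' y else e x.

Definition extend L (x : T) (p : {ffun 'I_L -> T}) : {ffun 'I_L.+1 -> T} :=
  [ffun j => oapp p x (unlift ord_max j)].

(** Peel off the leftmost edge, fixed to x, and classify the remaining functions by their new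
    leftmost value; [extend] puts the removed edge back. *)
Lemma path_sumE L x :
  \sum_(p : {ffun 'I_L.+1 -> T} | p ord_max == x)
     (\prod_(j < L) w j (p (lift ord0 j)) (p (widen_ord (leqnSn L) j)))
       * e (p ord0)
  = path_sum L x.
Proof.
elim: L x => [|L IHL] x /=.
  rewrite (reindex_onto (fun y => [ffun=> y] : {ffun 'I_1 -> T})
             (fun p => p ord_max)) => [|p _]; last first.
    by apply/ffunP=> j; rewrite ffunE; congr (p _); rewrite !ord1.
  rewrite (eq_bigl (pred1 x)) => [|y]; last by rewrite !ffunE eqxx andbT.
  by rewrite big_pred1_eq big_ord0 mul1r ffunE.
have widenE (j : 'I_L.+1) : widen_ord (leqnSn L.+1) j = lift ord_max j.
  by apply: val_inj; rewrite /= /bump leqNgt ltn_ord.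
rewrite (reindex_onto (extend x)
   (fun p => [ffun j : 'I_L.+1 => p (lift ord_max j)])) => [|p /eqP px].
  rewrite (eq_bigl predT) => [|p]; last first.
    rewrite ffunE unlift_none eqxx /=; apply/eqP/ffunP=> j.
    by rewrite !ffunE liftK.
  rewrite (partition_big (fun p : {ffun 'I_L.+1 -> T} => p ord_max) predT) //=.
  apply: eq_bigr => y _; rewrite -IHL mulr_sumr; apply: eq_bigr => p /eqP py.
  have extE (j : 'I_L.+1) (k : 'I_L.+2) : k = j :> nat -> extend x p k = p j.
    move=> jk; rewrite ffunE (_ : k = lift ord_max j) ?liftK //.
    by rewrite -widenE; apply: val_inj.
  rewrite big_ord_recr /= [X in _ * X * _](_ : _ = w L x y); last first.
    rewrite (extE ord_max (widen_ord _ _)) // py ffunE.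
    rewrite (_ : lift _ _ = ord_max) ?unlift_none //.
    by apply: val_inj.
  rewrite (extE ord0) // [X in X * _]mulrC -!mulrA; congr (_ * (_ * _)).
  by apply: eq_bigr => j _; congr (w _ _ _); exact: extE.
apply/ffunP=> j; rewrite ffunE; case: unliftP => [k ->|->] /=.
  by rewrite ffunE.
by rewrite px.
Qed.

End PathSum.

(** * Column-by-column recursion for a Delta-Gamma pair *)

Section TwoRows.
Variables (F : fieldType) (n : nat) (q z : F) (b : nat -> color n).
Implicit Types (c d x y : color n).

(* The edges e, e' are pairs (Gamma row color, Delta row color). *)
Definition two_row_wt j (e e' : color n * color n) : F :=
  \sum_m gamma_wt q z e.1 None e'.1 m * delta_wt q z e.2 m e'.2 (b j).

Definition two_row_sum : nat -> color n * color n -> F :=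
  path_sum two_row_wt (fun e => cap_wt F e.1 e.2).

(** Distinct left and top colors either go straight or turn; writing the support with indicators
    makes later sums collapse. *)
Lemma gamma_wtE l t r d : gamma_wt q z l t r d =
  if l == t then (r == l)%:R * (d == l)%:R
  else (r == l)%:R * (d == t)%:R * gamma_wt q z l t l t
     + (r == t)%:R * (d == l)%:R * gamma_wt q z l t t l.
Proof.
rewrite /gamma_wt !eqxx /=.
case: (eqVneq l t) => lt; case: (eqVneq r t) => rt; case: (eqVneq r l) => rl;
case: (eqVneq d t) => dt; case: (eqVneq d l) => dl; subst;
rewrite ?eqxx ?andbF /= ?mulr1 ?mulr0 ?mul0r ?mul1r ?addr0 ?add0r //=.
all: try by match goal with
  H : is_true (?x != ?x) |- _ => rewrite eqxx in H end.
all: rewrite ?(eq_sym _ d) ?(negPf rt) ?(negPf dt) //.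
Qed.

(** The left, top and bottom colors determine the right one, so a sum over right edges has a single
    term. *)
Lemma delta_wtE l t r d : delta_wt q z l t r d =
  if l == t then (r == d)%:R * delta_wt q z l l d d
  else (r == l)%:R * (d == t)%:R * delta_wt q z l t l t.
Proof.
rewrite /delta_wt !eqxx /=.
case: (eqVneq l t) => lt; case: (eqVneq r t) => rt; case: (eqVneq r l) => rl;
case: (eqVneq d t) => dt; case: (eqVneq d l) => dl; case: (eqVneq r d) => rd;
subst;
rewrite ?eqxx ?andbF /= ?mulr1 ?mulr0 ?mul0r ?mul1r ?addr0 ?add0r //=.
all: try by match goal with
  H : is_true (?x != ?x) |- _ => rewrite eqxx in H end.
Qed.

(** Under a top edge +, a color x of the Gamma row either stays in it, with + below, or drops, with
    + to its right: these are the two summands. *)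
Lemma two_row_sumS L x y : two_row_sum L.+1 (x, y) =
  if x == None
  then \sum_y' delta_wt q z y None y' (b L) * two_row_sum L (None, y')
  else gamma_wt q z x None x None *
         \sum_y' delta_wt q z y None y' (b L) * two_row_sum L (x, y')
     + gamma_wt q z x None None x *
         \sum_y' delta_wt q z y x y' (b L) * two_row_sum L (None, y').
Proof.
rewrite /two_row_sum /= -/two_row_sum.
transitivity (\sum_x' \sum_m gamma_wt q z x None x' m *
   \sum_y' delta_wt q z y m y' (b L) * two_row_sum L (x', y')).
  transitivity (\sum_x' \sum_y' two_row_wt L (x, y) (x', y') *
                             two_row_sum L (x', y')).
    by rewrite pair_bigA; apply: eq_bigr => -[].
  apply: eq_bigr => x' _; under eq_bigr do rewrite mulr_suml.
  rewrite exchange_big; apply: eq_bigr => m _; rewrite mulr_sumr.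
  by apply: eq_bigr => y' _; rewrite mulrA.
have inner x' (f : color n -> F) :
    \sum_m gamma_wt q z x None x' m * f m =
    if x == None then (x' == x)%:R * f x
    else (x' == x)%:R * (gamma_wt q z x None x None * f None)
       + (x' == None)%:R * (gamma_wt q z x None None x * f x).
  under eq_bigr do rewrite gamma_wtE.
  case: eqP => _.
    by under eq_bigr do rewrite -mulrA; rewrite -mulr_sumr sum_indicator.
  under eq_bigr do rewrite mulrDl -!mulrA.
  by rewrite big_split -!mulr_sumr !sum_indicator.
rewrite (eq_bigr _ (fun x' _ => inner x' _)).
case: (x =P None) => [->|_]; first by rewrite sum_indicator.
by rewrite big_split /= !sum_indicator.
Qed.

Lemma delta_sum l t d (f : color n -> F) :
  \sum_y delta_wt q z l t y d * f y =
  if l == t then delta_wt q z l l d d * f d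
  else (d == t)%:R * delta_wt q z l t l t * f l.
Proof.
under eq_bigr do rewrite delta_wtE.
case: eqP => _; under eq_bigr do rewrite -!mulrA; rewrite sum_indicator //.
by rewrite mulrA.
Qed.

End TwoRows.

(** * Closed form of the two-row sums *)

Section TwoRowClosedForm.
Variables (F : fieldType) (n : nat) (q z : F) (b : nat -> color n).
Notation R := (two_row_sum q z b).
Notation g := (@gamma_wt F n q z).
Notation d := (@delta_wt F n q z).

Definition vacant L : F := \prod_(j < L) (b j == None)%:R.

Lemma vacantS L : vacant L.+1 = (b L == None)%:R * vacant L.
Proof. by rewrite /vacant big_ord_recr mulrC. Qed.

(** Below a Gamma row of +, a color in the Delta row can only go on to the cap, where it has no
    partner. *)
Lemma two_row_sum0 L c : R L (None, c) = (c == None)%:R * vacant L.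
Proof.
elim: L c => [|L IHL] c; first by rewrite /vacant big_ord0 mulr1.
rewrite two_row_sumS eqxx delta_sum vacantS.
case: c => [a|] /=; rewrite IHL /=; first by rewrite !mul0r mulr0.
by case: (b L) => [a|]; rewrite /= ?mul0r ?mulr0 // /delta_wt !mul1r.
Qed.

(* The color k enters L columns in the Gamma row and leaves them, leftwards, as c
   in the Delta row: it turns at the cap if c = bar k, and by a drop in one of
   the L columns if c = k. *)
Definition turn_wt (k : signed n) L (c : signed n) : F :=
  let pass := g (Some k) None (Some k) None * d (Some c) None (Some c) None in
  if c == bar k then pass ^+ L
  else if c == k then
    g (Some k) None None (Some k) * d (Some k) (Some k) None None *
    \sum_(i < L) pass ^+ i
  else 0.

Lemma bar_neq (k : signed n) : (k == bar k) = false.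
Proof. by case: k => -[] i; rewrite /bar xpair_eqE. Qed.

Lemma two_row_sum_turn k c L : R L (Some k, Some c) = turn_wt k L c * vacant L.
Proof.
elim: L => [|L IHL].
  rewrite /vacant big_ord0 mulr1 /two_row_sum /= /cap_wt /turn_wt big_ord0 mulr0.
  rewrite expr0 if_same (inj_eq (@Some_inj _)) /=.
  by case: eqP.
rewrite two_row_sumS /= !delta_sum /= IHL !two_row_sum0 /= mul0r mulr0 vacantS.
rewrite (inj_eq (@Some_inj _)) /turn_wt.
case: (eqVneq c k) => [->|ck].
  rewrite bar_neq; case: (b L =P None) => [->|_]; last first.
    by rewrite !(mul0r, mulr0) addr0.
  (* The term 1 is a drop in the leftmost column; every other drop first passes that column. *)
  have sumXS (a : F) : \sum_(i < L.+1) a ^+ i = 1 + a * \sum_(i < L) a ^+ i.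
    rewrite big_ord_recl mulr_sumr; congr (_ + _).
    by apply: eq_bigr => i _; rewrite -exprS.
  by rewrite sumXS /=; ring.
by do 2!case: eqP => _; rewrite ?exprS /=; ring.
Qed.

(** With + to its left, a Delta vertex sends a dropped k straight to the bottom. So k must pass
    above a bottom +; above a bottom c it passes, or drops through both rows if c = k. *)
Lemma two_row_sumSE k L : R L.+1 (Some k, None) =
  if b L is Some c then
    (g (Some k) None (Some k) None * d None None (Some c) (Some c)
       * turn_wt k L c
     + (c == k)%:R * g (Some k) None None (Some k)
       * d None (Some k) None (Some k))
    * vacant L
  else g (Some k) None (Some k) None * R L (Some k, None).
Proof.
rewrite two_row_sumS /= !delta_sum /= two_row_sum0 mul1r.
case: (b L) => [c|].
  by rewrite two_row_sum_turn (inj_eq (@Some_inj _)); ring.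
by rewrite /delta_wt /= mul0r mul0r mulr0 addr0 mul1r.
Qed.

End TwoRowClosedForm.

(** * Functional equation for the two-row sums *)

Lemma geometric_sum (F : fieldType) (a : F) L :
  1 - a != 0 -> \sum_(i < L) a ^+ i = (1 - a ^+ L) / (1 - a).
Proof.
move=> a1; apply: (canRL (mulfK a1)).
by rewrite -opprB -[X in _ = X]opprB subrX1 mulrN mulrC.
Qed.

(* The next two identities are the case of a bottom color in the column with L
   columns to its right; P, P', Q stand for the L-th powers of z, z', q. *)
Lemma barred_column_identity (F : fieldType) (q z z' P P' Q : F)
    (C := (q - z') * (z - 1) / (q * (1 - z * z')))
    (D := (q * z + z' - (q + 1) * z * z') / (q * (1 - z * z'))) :
  q != 0 -> z != 0 -> z' != 0 -> 1 - z * z' != 0 ->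
  P != 0 -> P' != 0 -> Q != 0 ->
  q / z * (Q / P) * (z * (1 - z') *
      ((1 - z) * (1 - q^-1 * z') * ((1 - P * P') / (1 - z * z')))
    + (1 - z) * (q^-1 * z')) =
  C / (z * P) * (q * z * (1 - z') * (Q * P * P'))
  - D * (z' * P') * (q * z'^-1 * (1 - z^-1) * (Q / P' / P)).
Proof.
move=> q0 z0 z'0 w0 P0 P'0 Q0; rewrite /C /D; field.
by rewrite q0 z0 P0 P'0 z'0 w0.
Qed.

Lemma unbarred_column_identity (F : fieldType) (q z P P' Q : F)
    (z' := zprime q z)
    (C := (q - z') * (z - 1) / (q * (1 - z * z')))
    (D := (q * z + z' - (q + 1) * z * z') / (q * (1 - z * z'))) :
  q != 0 -> z != 0 -> z' != 0 -> 1 - z * z' != 0 ->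
  P != 0 -> P' != 0 -> Q != 0 ->
  q / z * (Q / P) * (z * (1 - q^-1 * z') * (P * (Q^-1 * P'))) =
  C / (z * P) * (q * z * (1 - q^-1 * z') *
      ((1 - q * z) * (1 - z') * ((1 - P * P') / (1 - z * z')))
    + (1 - q * z) * z')
  - D * (z' * P') * (q * z'^-1 * (1 - q^-1 * z^-1) *
      ((1 - q * z'^-1) * (1 - z^-1) * ((1 - P'^-1 * P^-1) / (1 - z'^-1 * z^-1)))
    + (1 - q * z'^-1) * z^-1).
Proof.
(* With z' expanded, the side conditions of [field] involve (q + 1) z - 1, which is z z'. *)
have w1 : z != 0 -> z * z' = (q + 1) * z - 1.
  by move=> z0; rewrite /z' /zprime; field.
move=> q0 z0 z'0 w0 P0 P'0 Q0; rewrite /C /D /z' /zprime; field.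
rewrite q0 z0 P0 P'0 Q0 -w1 // mulf_neq0 // /=.
by rewrite -opprB oppr_eq0 w0.
Qed.

Section SignedWeights.
Variables (F : fieldType) (n : nat) (i : 'I_n) (q x : F).
Notation K := (Some (false, i) : color n).
Notation Kbar := (Some (true, i) : color n).

Lemma gamma_wt_unbarred :
  (gamma_wt q x K None K None = q * x) *
  (gamma_wt q x K None None K = 1 - q * x).
Proof. by split; rewrite /gamma_wt /= !eqxx. Qed.

Lemma gamma_wt_barred :
  (gamma_wt q x Kbar None Kbar None = x) *
  (gamma_wt q x Kbar None None Kbar = 1 - x).
Proof. by split; rewrite /gamma_wt /= !eqxx. Qed.

Lemma delta_wt_unbarred :
  (delta_wt q x None K None K = zprime q x) *
  (delta_wt q x K None K None = q^-1 * zprime q x) *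
  (delta_wt q x K K None None = 1 - zprime q x) *
  (delta_wt q x None None K K = 1 - q^-1 * zprime q x).
Proof. by do !split; rewrite /delta_wt /= !eqxx. Qed.

Lemma delta_wt_barred :
  (delta_wt q x None Kbar None Kbar = q^-1 * zprime q x) *
  (delta_wt q x Kbar None Kbar None = zprime q x) *
  (delta_wt q x Kbar Kbar None None = 1 - q^-1 * zprime q x) *
  (delta_wt q x None None Kbar Kbar = 1 - zprime q x).
Proof. by do !split; rewrite /delta_wt /= !eqxx. Qed.

End SignedWeights.

Definition signed_wtE := (gamma_wt_unbarred, gamma_wt_barred,
  delta_wt_unbarred, delta_wt_barred).

(** Induction on columns from the left: a bottom + multiplies every term by q, and the first bottom
    color met reduces the claim to one of the two identities above. *)
Lemma two_row_sum_functional (F : fieldType) (n : nat) (i : 'I_n) (q z : F)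
    (b : nat -> color n) (L : nat) (z' := zprime q z)
    (C := (q - z') * (z - 1) / (q * (1 - z * z')))
    (D := (q * z + z' - (q + 1) * z * z') / (q * (1 - z * z'))) :
  q != 0 -> z != 0 -> z' != 0 -> 1 - z * z' != 0 ->
  (q / z) ^+ L * two_row_sum q z b L (Some (true, i), None) =
  C * z ^- L * two_row_sum q z b L (Some (false, i), None)
  - D * z' ^+ L * two_row_sum q z'^-1 b L (Some (false, i), None).
Proof.
move=> q0 z0 z'0 w0; have zp : zprime q z'^-1 = z^-1.
  by rewrite /zprime invrK /z' /zprime; ring.
have w'0 : 1 - z'^-1 * z^-1 != 0.
  apply: contraNneq w0 => /(congr1 ( *%R (z * z'))).
  rewrite mulr0 => E; apply/eqP; rewrite -[RHS]oppr0 -E.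
  by field; rewrite z0 z'0.
(* The factors q and 1/q of an unbarred color cancel, leaving the ratio z z' of the geometric
   sums. *)
have qK x y : q * x * (q^-1 * y) = x * y by field.
elim: L => [|L IHL]; first by rewrite /two_row_sum /= /cap_wt /= !mulr0 subr0.
rewrite !two_row_sumSE !exprS.
case bL: (b L) => [c|]; last first.
  rewrite !signed_wtE.
  transitivity
    (q * ((q / z) ^+ L * two_row_sum q z b L (Some (true, i), None))).
    by field.
  by rewrite IHL; clearbody C D z'; field; rewrite expf_neq0 ?z0 ?z'0.
rewrite !mulrA -mulrBl -[D * z' * _]mulrA; congr (_ * _).
have [P0 P'0 Q0] : [/\ z ^+ L != 0, z' ^+ L != 0 & q ^+ L != 0].
  by rewrite !expf_neq0.
rewrite /turn_wt /bar /=.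
(* Here the left-hand side drops its color, giving a geometric sum, while both right-hand terms turn
   at the cap; for c = (false, i) the roles are exchanged. *)
case: (eqVneq c (true, i)) => [->|ct].
  rewrite !xpair_eqE !signed_wtE !zp geometric_sum //=.
  rewrite !mul0r !mul1r !addr0 !exprMn !exprVn.
  exact: barred_column_identity.
case: (eqVneq c (false, i)) => [->|cf].
  rewrite !signed_wtE !zp !qK !geometric_sum //=.
  rewrite !mul0r !mul1r !addr0 !exprMn !exprVn.
  exact: unbarred_column_identity.
by rewrite !(mulr0, mul0r, addr0) subr0.
Qed.

(** * Cutting the lattice below the top pair of rows *)

Lemma forall_ord_recr n (P : pred 'I_n.+1) :
  [forall i, P i] = [forall i : 'I_n, P (widen_ord (leqnSn n) i)] && P ord_max.
Proof.
apply/forallP/andP => [Pall|[/forallP Plow Pmax] i].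
  by split=> //; apply/forallP.
case: (unliftP ord_max i) => [j ->|-> //].
rewrite (_ : lift _ _ = widen_ord (leqnSn n) j) //.
by apply: val_inj; exact: lift_max.
Qed.

Section Glue.
Variables (F : fieldType) (n L : nat).
Notation col := (color n.+1).

Definition lower_edges : finType :=
  ({ffun 'I_n.*2 * 'I_L.+1 -> col} * {ffun 'I_n.*2.+1 * 'I_L -> col})%type.

(* Horizontal edges are (Gamma row, Delta row) pairs. *)
Definition upper_edges : finType :=
  ({ffun 'I_L.+1 -> col * col} * {ffun 'I_L -> col})%type.

(** Vertical layers up to 2n, the interface included, come from the lower part; layer 2n+1 lies
    inside the top pair, and the topmost layer is set to +. *)
Definition glue (lu : lower_edges * upper_edges) : state n.+1 L :=
  ([ffun rj : 'I_n.+1.*2 * 'I_L.+1 =>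
      if insub (val rj.1) is Some r then lu.1.1 (r, rj.2)
      else if val rj.1 == n.*2 then (lu.2.1 rj.2).2 else (lu.2.1 rj.2).1],
   [ffun rj : 'I_n.+1.*2.+1 * 'I_L =>
      if insub (val rj.1) is Some r then lu.1.2 (r, rj.2)
      else if val rj.1 == n.*2.+1 then lu.2.2 rj.2 else None]).

(** The ordinal types are those of rank n.+1 up to conversion, with the successor exposed for
    [inord]. *)
Definition cut (s : state n.+1 L) : lower_edges * upper_edges :=
  (([ffun rj : 'I_n.*2 * 'I_L.+1 => hedge s (inord rj.1 : 'I_n.*2.+2) rj.2],
    [ffun rj : 'I_n.*2.+1 * 'I_L => vedge s (inord rj.1 : 'I_n.*2.+3) rj.2]),
   ([ffun j => (hedge s (inord n.*2.+1 : 'I_n.*2.+2) j,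
                hedge s (inord n.*2 : 'I_n.*2.+2) j)],
    [ffun j => vedge s (inord n.*2.+1 : 'I_n.*2.+3) j])).

Section GlueEdges.
Variables (l : lower_edges) (u : upper_edges).
Notation s := (glue (l, u)).

Lemma hedge_glue_lower (r : 'I_n.+1.*2) (r' : 'I_n.*2) j :
  r = r' :> nat -> hedge s r j = l.1 (r', j).
Proof. by move=> rr'; rewrite /hedge ffunE /= rr' valK. Qed.

Lemma hedge_glue_delta (r : 'I_n.+1.*2) j :
  r = n.*2 :> nat -> hedge s r j = (u.1 j).2.
Proof. by move=> rn; rewrite /hedge ffunE /= rn insubF ?ltnn ?eqxx. Qed.

Lemma hedge_glue_gamma (r : 'I_n.+1.*2) j :
  r = n.*2.+1 :> nat -> hedge s r j = (u.1 j).1.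
Proof.
move=> rn; rewrite /hedge ffunE /= rn insubF; first by rewrite gtn_eqF.
by rewrite ltnNge leqnSn.
Qed.

Lemma vedge_glue_lower (r : 'I_n.+1.*2.+1) (r' : 'I_n.*2.+1) j :
  r = r' :> nat -> vedge s r j = l.2 (r', j).
Proof. by move=> rr'; rewrite /vedge ffunE /= rr' valK. Qed.

Lemma vedge_glue_middle (r : 'I_n.+1.*2.+1) j :
  r = n.*2.+1 :> nat -> vedge s r j = u.2 j.
Proof. by move=> rn; rewrite /vedge ffunE /= rn insubF ?ltnn ?eqxx. Qed.

Lemma vedge_glue_top (r : 'I_n.+1.*2.+1) j :
  r = n.*2.+2 :> nat -> vedge s r j = None.
Proof.
move=> rn; rewrite /vedge ffunE /= rn insubF; first by rewrite gtn_eqF.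
by rewrite ltnNge leqnSn.
Qed.

End GlueEdges.

Lemma glueK : cancel glue cut.
Proof.
move=> [l u]; rewrite /cut.
rewrite [l in RHS]surjective_pairing [u in RHS]surjective_pairing.
congr (_, _, (_, _)); apply/ffunP; [case=> r j|case=> r j|move=> j|move=> j];
  rewrite ffunE /=.
- by apply: hedge_glue_lower; rewrite inordK // ltnS ltnW // ltnS ltnW.
- by apply: vedge_glue_lower; rewrite inordK // ltnS ltnW // ltnS ltnW.
- rewrite hedge_glue_gamma ?inordK // hedge_glue_delta ?inordK //.
  by rewrite -surjective_pairing.
- by rewrite vedge_glue_middle // inordK.
Qed.

(** The top edges are not stored by [cut], hence the boundary hypothesis. *)
Lemma cutK (s : state n.+1 L) :
  (forall j, vedge s ord_max j = None) -> glue (cut s) = s.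
Proof.
move=> top; rewrite [s in RHS]surjective_pairing [glue _]surjective_pairing.
congr (_, _); apply/ffunP => -[r j].
  rewrite -/(hedge (glue (cut s)) r j) -/(hedge s r j).
  have [rn|nr|rn] := ltngtP r n.*2.
  - rewrite (@hedge_glue_lower _ _ r (Ordinal rn)) // ffunE /=.
    by congr hedge; apply: val_inj; rewrite /= inordK.
  - have rn : r = n.*2.+1 :> nat.
      by apply/eqP; rewrite eqn_leq nr -ltnS andbT; case: (r).
    rewrite hedge_glue_gamma // ffunE /=.
    by congr hedge; apply: val_inj; rewrite /= inordK.
  - rewrite hedge_glue_delta // ffunE /=.
    by congr hedge; apply: val_inj; rewrite /= inordK.
rewrite -/(vedge (glue (cut s)) r j) -/(vedge s r j).
have [rn|nr|rn] := ltngtP r n.*2.+1.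
- rewrite (@vedge_glue_lower _ _ r (Ordinal rn)) // ffunE /=.
  by congr vedge; apply: val_inj; rewrite /= inordK.
- have rn : r = n.*2.+2 :> nat.
    by apply/eqP; rewrite eqn_leq nr -ltnS andbT; case: (r).
  rewrite vedge_glue_top // -(top j).
  by congr vedge; apply: val_inj; rewrite /= rn.
- rewrite vedge_glue_middle // ffunE /=.
  by congr vedge; apply: val_inj; rewrite /= inordK.
Qed.

Variables (lam : 'I_n.+1 -> nat) (sigma tau : {perm signed n.+1}).
Variables (q : F) (z : 'I_n.+1 -> F).

Let widen (i : 'I_n) : 'I_n.+1 := widen_ord (leqnSn n) i.

Definition lower_compatible (l : lower_edges) : bool :=
  [&& [forall i : 'I_n,
         l.1 (gamma_row i, ord_max) == Some (sigma (pos (widen i)))],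
      [forall i : 'I_n, l.1 (delta_row i, ord_max) == None]
    & [forall j : 'I_L, l.2 (ord0, j) == bottom_bc lam tau j]].

Definition lower_wt (l : lower_edges) : F :=
  \prod_(i < n)
    ((\prod_(j < L)
        (gamma_wt q (z (widen i))
           (l.1 (gamma_row i, lift ord0 j)) (l.2 (lift ord0 (gamma_row i), j))
           (l.1 (gamma_row i, widen_ord (leqnSn L) j))
           (l.2 (widen_ord (leqnSn n.*2) (gamma_row i), j)) *
         delta_wt q (z (widen i))
           (l.1 (delta_row i, lift ord0 j)) (l.2 (lift ord0 (delta_row i), j))
           (l.1 (delta_row i, widen_ord (leqnSn L) j))
           (l.2 (widen_ord (leqnSn n.*2) (delta_row i), j)))) *
     cap_wt F (l.1 (gamma_row i, ord0)) (l.1 (delta_row i, ord0))).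

(* The default color off the lattice is never read. *)
Definition interface (l : lower_edges) (j : nat) : col :=
  if insub j is Some j' then l.2 (ord_max, j') else None.

Lemma compatible_glue l (u : upper_edges) :
  compatible lam sigma tau (glue (l, u)) =
  lower_compatible l && (u.1 ord_max == (Some (sigma (pos ord_max)), None)).
Proof.
have topE : [forall j, vedge (glue (l, u)) ord_max j == None].
  by apply/forallP => j; rewrite vedge_glue_top.
have bottomE : [forall j, vedge (glue (l, u)) ord0 j == bottom_bc lam tau j] =
               [forall j, l.2 (ord0, j) == bottom_bc lam tau j].
  by apply: eq_forallb => j; rewrite (@vedge_glue_lower _ _ _ ord0).
rewrite /compatible /lower_compatible topE bottomE /=.
rewrite !forall_ord_recr hedge_glue_gamma // hedge_glue_delta //.
under eq_forallb => i do rewrite (@hedge_glue_lower _ _ _ (gamma_row i)) //.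
rewrite -!andbA; congr (_ && _).
under eq_forallb => i do rewrite (@hedge_glue_lower _ _ _ (delta_row i)) //.
rewrite [u.1 ord_max]surjective_pairing xpair_eqE /=.
by do !case: (_ == _) => //=; rewrite ?andbT ?andbF.
Qed.

Lemma state_wt_glue l (p : {ffun 'I_L.+1 -> col * col})
    (m : {ffun 'I_L -> col}) :
  state_wt q z (glue (l, (p, m))) = lower_wt l *
  ((\prod_(j < L)
      (gamma_wt q (z ord_max) (p (lift ord0 j)).1 None
         (p (widen_ord (leqnSn L) j)).1 (m j) *
       delta_wt q (z ord_max) (p (lift ord0 j)).2 (m j)
         (p (widen_ord (leqnSn L) j)).2 (interface l j)))
   * cap_wt F (p ord0).1 (p ord0).2).
Proof.
rewrite /state_wt big_ord_recr /=; congr (_ * _).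
  apply: eq_bigr => i _; congr (_ * _).
    apply: eq_bigr => j _.
    rewrite /left_edge /right_edge /top_edge /bottom_edge.
    congr (_ * _); congr (_ _ _ _ _ _ _);
      first [exact: hedge_glue_lower | exact: vedge_glue_lower].
  by congr cap_wt; exact: hedge_glue_lower.
have gammaE j := @hedge_glue_gamma l (p, m) (gamma_row ord_max) j erefl.
have deltaE j := @hedge_glue_delta l (p, m) (delta_row ord_max) j erefl.
rewrite gammaE deltaE; congr (_ * _); apply: eq_bigr => j _.
rewrite /left_edge /right_edge /top_edge /bottom_edge !gammaE !deltaE.
rewrite (vedge_glue_top _ _ (r := lift ord0 (gamma_row ord_max))) //.
rewrite (vedge_glue_middle _ _ (r := lift ord0 (delta_row ord_max))) //.
rewrite (vedge_glue_middle _ _ (r := widen_ord _ (gamma_row ord_max))) //.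
rewrite (@vedge_glue_lower _ _ _ ord_max) //.
by rewrite /interface valK.
Qed.

Lemma partition_function_split :
  partition_function L lam sigma tau q z =
  \sum_(l | lower_compatible l) lower_wt l *
     two_row_sum q (z ord_max) (interface l) L
       (Some (sigma (pos ord_max)), None).
Proof.
rewrite /partition_function (reindex_onto glue cut) /=; last first.
  by move=> s /and4P[_ _ /forallP top _]; apply: cutK => j; apply/eqP.
under eq_bigl => lu do rewrite glueK eqxx andbT.
transitivity (\sum_(l | lower_compatible l)
    \sum_(u : upper_edges | u.1 ord_max == (Some (sigma (pos ord_max)), None))
      state_wt q z (glue (l, u))).
  rewrite pair_big_dep /=; apply: eq_big => [[l u]|[l u] //].
  exact: compatible_glue.
apply: eq_bigr => l _; rewrite /two_row_sum -path_sumE mulr_sumr.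
transitivity (\sum_(p : {ffun 'I_L.+1 -> col * col} |
     p ord_max == (Some (sigma (pos ord_max)), None))
   \sum_(m : {ffun 'I_L -> col}) state_wt q z (glue (l, (p, m)))).
  rewrite pair_big_dep /=; apply: eq_big => [[p m]|[p m] //] /=.
  by rewrite andbT.
apply: eq_bigr => p _; under eq_bigr do rewrite state_wt_glue.
(* Each edge between the two rows belongs to one column, so the sum over all of them factors into
   the column sums [two_row_wt]. *)
by rewrite -mulr_sumr -mulr_suml /two_row_wt bigA_distr_bigA.
Qed.

End Glue.

(* The rank called n in the text is n.+1 here, and z_n is z ord_max. *)
Theorem theorem3p5 (F : fieldType) (n L : nat) (lam : 'I_n.+1 -> nat)
    (sigma tau : {perm signed n.+1}) (q : F) (z : 'I_n.+1 -> F)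
    (zn := z ord_max) (zn' := zprime q zn)
    (C := (q - zn') * (zn - 1) / (q * (1 - zn * zn')))
    (D := (q * zn + zn' - (q + 1) * zn * zn') / (q * (1 - zn * zn')))
    (hlam : forall i j : 'I_n.+1, (i <= j)%N -> (lam j <= lam i)%N)
    (hL : (lam ord0 + n.+1 <= L)%N)
    (hsigma : sigma \in hyperoct n.+1) (htau : tau \in hyperoct n.+1)
    (hpos : 0 < label (Some (sigma (pos ord_max))))
    (hq : q != 0) (hz : forall i : 'I_n.+1, z i != 0)
    (hzn' : zn' != 0) (hznzn' : 1 - zn * zn' != 0) :
  (q / zn) ^+ L * partition_function L lam (s_last n * sigma)%g tau q z =
    C * zn ^- L * partition_function L lam sigma tau q z
    - D * zn' ^+ L * partition_function L lam sigma tau q (s_last_params q z).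
Proof.
have pmax (i : 'I_n) : widen_ord (leqnSn n) i != ord_max.
  by rewrite -val_eqE /= ltn_eqF.
have [i0 sigma_max] : exists i, sigma (pos ord_max) = (false, i).
  by move: hpos; case: (sigma _) => -[] i //; exists i.
have sigma_bar : sigma (bar (pos ord_max)) = (true, i0).
  move: hsigma; rewrite inE => /forallP/(_ (pos ord_max))/eqP->.
  by rewrite sigma_max.
have lower_sigma (l : lower_edges n L) :
    lower_compatible lam (s_last n * sigma)%g tau l =
    lower_compatible lam sigma tau l.
  rewrite /lower_compatible; congr (_ && _); apply: eq_forallb => i.
  rewrite permM /s_last tpermD // /pos /bar xpair_eqE ?andbF //=.
  by rewrite eq_sym pmax.
have lower_z (l : lower_edges n L) :
    lower_wt q (s_last_params q z) l = lower_wt q z l.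
  by apply: eq_bigr => i _; rewrite /s_last_params (negPf (pmax i)).
(* The lower part is common to all three terms; s_n only replaces the left color k of the top Gamma
   row by its bar. *)
rewrite !partition_function_split permM tpermL sigma_max sigma_bar.
rewrite [s_last_params q z ord_max]/s_last_params eqxx.
rewrite (eq_bigl _ _ lower_sigma) !mulr_sumr -sumrB; apply: eq_bigr => l _.
rewrite lower_z [LHS]mulrCA two_row_sum_functional ?hz //.
by rewrite mulrBr; congr (_ - _); rewrite mulrCA.
Qed.
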